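(* Let $\sigma\in\{1,-1\}$, and let $w_1,\dots,w_n$, $\widehat w_1,\dots,\widehat w_n$, $\Omega$, $V$ and the Hamiltonian $$H(\mathbf z,\mathbf Z)=\frac{(1+\sigma|\mathbf z|^2)^2}{4}|\mathbf Z|^2+2\Omega\,\mathrm{Im}(\mathbf z\overline{\mathbf Z})-2V(\mathbf z,\overline{\mathbf z})$$ of the restricted curved $(n+1)$-body problem be as in the context. Then the transformation $$\mathbf z=g(w)=\frac{n-1}{n}\,w+\frac{w_1^n}{n\,w^{n-1}}$$ and the time transformation $$\frac{dt}{ds}=\frac{(n-1)^2}{n^2}\,\frac{|w-w_1|^2|w-w_2|^2\cdots|w-w_n|^2}{|w|^{2n}}$$ regularize the $n$ binary collision singularities of $H$ between the negligible mass and each of the primaries.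
   Context: Restricted curved $(n+1)$-body problem. $\sigma=1$ corresponds to the unit sphere $\mathbb S^2\subset\mathbb R^3$, and $\sigma=-1$ to the hyperbolic plane $\mathbb H^2=\{x^2+y^2-z^2=-1,\ z>0\}$. A regular $n$-gon ($n\ge 2$) of primaries with equal (unit) masses lies at constant height $z\neq 0$ on a circle of radius $r>0$ (so $r^2+\sigma z^2=\sigma$) and rotates rigidly about the $z$-axis with angular velocity $\Omega$, as a relative equilibrium, where $$\Omega^2=\sum_{j=1}^{n-1}\frac{1-\cos(2\pi j/n)}{[\sigma-\sigma(r^2\cos(2\pi j/n)+\sigma-r^2)^2]^{3/2}}.$$ A further body of negligible mass moves under the attraction of the primaries without affecting them. In the rotating frame the primaries are fixed at $(k_j,h_j,z)$ with $k_j=r\cos(2\pi(j-1)/n)$, $h_j=r\sin(2\pi(j-1)/n)$. After stereographic projection from $(0,0,-1)$ to $\mathbb C$, the primaries are at $w_j=\frac{k_j+ih_j}{1+z}$; put $\widehat w_j=-\frac{k_j+ih_j}{1-z}$. The position of the negligible mass is $\mathbf z=u+iv$ (in the open unit disk if $\sigma=-1$), its momentum is $\mathbf Z=p_u+ip_v$, and $$V(\mathbf z,\overline{\mathbf z})=\sum_{j=1}^n\frac{k_j(\mathbf z+\overline{\mathbf z})-ih_j(\mathbf z-\overline{\mathbf z})+\sigma z(1-\sigma|\mathbf z|^2)}{r\,|\mathbf z-w_j|\,|\mathbf z-\widehat w_j|},$$ where the non-bold $z$ is the constant height of the primaries. The $n$ binary collision singularities of $H$ are $\mathbf z=w_1,\dots,\mathbf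 z=w_n$. Meaning of ''regularize'': the momentum is changed by $\mathbf Z=W/\overline{g'(w)}$, and $dt/ds=|g'(w)|^2$. On a fixed energy level $H=-C/2$ one passes to the Hamiltonian $\hat H=|g'(w)|^2\left(H+\frac C2\right)$, expressed in $(w,W)$ with time $s$ and considered at the level $\hat H=0$. To regularize the collision singularities means that the singularities due to the collisions $\mathbf z=w_j$, $j=1,\dots,n$, are no longer present in $\hat H$.
   Formalization: Regularity of the transformed Hamiltonian is claimed at the points w = w_j (zeros of dt/ds) only: for n ≥ 3 each w_j has further simple preimages under g (e.g. w = -w_j/2 for n = 3), where the collision pole persists. *)

(* Defs.v *)
From mathcomp Require Import all_boot all_order all_algebra.
From mathcomp Require Import all_classical all_reals all_analysis.
From mathcomp Require Export complex.

Set Implicit Arguments.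
Unset Strict Implicit.
Unset Printing Implicit Defensive.

Import Order.TTheory GRing.Theory Num.Theory.
Import numFieldNormedType.Exports.

Local Open Scope classical_set_scope.
Local Open Scope ring_scope.
Local Open Scope complex_scope.

(* The modulus as a real number; `|zeta| itself lives in R[i]. *)
Definition cabs (R : realType) (zeta : R[i]) : R := complex.Re `|zeta|.

(* Class C^k on U, for U open in a finite-dimensional space V: f is continuous,
   resp. differentiable with all its directional derivatives of class C^(k-1). *)
Fixpoint class_C (R : realType) (V : normedModType R) (k : nat)
    (U : set V) (f : V -> R) : Prop :=
  if k is k'.+1 then
    (forall x, U x -> differentiable f x) /\
    (forall v : V, class_C k' U (fun x => 'D_v f x))
  else forall x, U x -> {for x, continuous f}.

Definition smooth_on (R : realType) (V : normedModType R)
    (U : set V) (f : V -> R) : Prop := forall k, class_C k U f.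

(* Real phase space, ((u, v), (p_u, p_v)); R[i] is only normed over itself, so
   real smoothness is expressed in these coordinates. *)
Notation phase R := ((R * R) * (R * R))%type.

Definition toC (R : realType) (p : R * R) : R[i] := p.1 +i* p.2.

Section Problem.
Variables (R : realType) (sigma : R) (n : nat) (r z Omega : R).

Definition omega_sqr : R :=
  \sum_(1 <= j < n)
    (1 - cos (2 * pi * j%:R / n%:R)) /
    (sigma - sigma * (r ^+ 2 * cos (2 * pi * j%:R / n%:R) + sigma - r ^+ 2) ^+ 2)
      `^ (3 / 2).

Definition kk (j : nat) : R := r * cos (2 * pi * (j%:R - 1) / n%:R).
Definition hh (j : nat) : R := r * sin (2 * pi * (j%:R - 1) / n%:R).

(* Meaningful for 1 <= j <= n. *)
Definition primary (j : nat) : R[i] := (kk j +i* hh j) / (1 + z)%:C.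
Definition antipode (j : nat) : R[i] := - ((kk j +i* hh j) / (1 - z)%:C).

(* The numerator is a real element of R[i], hence the real part. *)
Definition potential (zeta : R[i]) : R :=
  \sum_(1 <= j < n.+1)
    complex.Re ((kk j)%:C * (zeta + (zeta^*)%C)
                - ('i)%C * (hh j)%:C * (zeta - (zeta^*)%C)
                + (sigma * z * (1 - sigma * cabs zeta ^+ 2))%:C)
    / (r * cabs (zeta - primary j) * cabs (zeta - antipode j)).

Definition hamiltonian (zeta Z : R[i]) : R :=
  (1 + sigma * cabs zeta ^+ 2) ^+ 2 / 4 * cabs Z ^+ 2
  + 2 * Omega * complex.Im (zeta * (Z^*)%C) - 2 * potential zeta.

(* Positions at which the Hamiltonian is defined. *)
Definition configuration : set R[i] :=
  [set zeta | (sigma = -1 -> cabs zeta < 1) /\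
    forall j, (1 <= j <= n)%N -> zeta != primary j /\ zeta != antipode j].

Definition g_map (w : R[i]) : R[i] :=
  (n%:R - 1) / n%:R * w + primary 1 ^+ n / (n%:R * w ^+ n.-1).

Definition dt_ds (w : R[i]) : R :=
  (n%:R - 1) ^+ 2 / n%:R ^+ 2
  * (\prod_(1 <= j < n.+1) cabs (w - primary j) ^+ 2) / cabs w ^+ (2 * n).

End Problem.

Section Regularization.
Variable R : realType.

(* R[i]^o is R[i] as a normed space over itself, so this is the complex
   derivative. *)
Definition cderive (g : R[i] -> R[i]) : R[i] -> R[i] :=
  derive1 (g : R[i] -> R[i]^o).

Definition transformed_hamiltonian (H : R[i] -> R[i] -> R) (g : R[i] -> R[i])
    (C : R) (w W : R[i]) : R :=
  cabs (cderive g w) ^+ 2 * (H (g w) (W / ((cderive g w)^*)%C) + C / 2).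

(* H is defined at the positions in Q, its collision singularities are
   c 1, ..., c n, and g is defined on D.  The collision with the primary at c j
   takes place at w = c j in the new variable, near which g covers a whole
   neighbourhood of the collision point.  The transformed Hamiltonian is a priori
   defined for w in D with g w in Q; that its singularities at w = c j are
   absent means that, for every energy, it extends to a smooth function of (w, W)
   on the set which contains these points too, with arbitrary momentum W.
   Only the preimages c j, the zeros of tau, are concerned: for n >= 3 the map
   g_map has further, simple preimages of each primary, at which the pole of the
   potential persists. *)
Definition regularizes (H : R[i] -> R[i] -> R) (Q : set R[i])
    (n : nat) (c : nat -> R[i])
    (D : set R[i]) (g : R[i] -> R[i]) (tau : R[i] -> R) : Prop :=
  [/\ forall w, D w -> derivable (g : R[i]^o -> R[i]^o) w 1 /\
        tau w = cabs (cderive g w) ^+ 2,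
      forall w, D w -> Q (g w) -> cderive g w != 0,
      forall j, (1 <= j <= n)%N ->
        [/\ D (c j), g (c j) = c j &
            forall N, nbhs (c j : R[i]^o) N -> nbhs (c j : R[i]^o) (g @` N)] &
      forall C : R, exists F : phase R -> R,
        smooth_on [set x | (D (toC x.1) /\ Q (g (toC x.1))) \/
                           exists2 j, (1 <= j <= n)%N & toC x.1 = c j] F
        /\ forall x, D (toC x.1) -> Q (g (toC x.1)) ->
             F x = transformed_hamiltonian H g C (toC x.1) (toC x.2)].

End Regularization.

(* Main.v *)
Require Import Defs.
From mathcomp Require Import all_boot all_order all_algebra.
From mathcomp Require Import all_classical all_reals all_analysis.
From mathcomp Require Import ring lra.

Import Order.TTheory GRing.Theory Num.Theory.
Import numFieldNormedType.Exports.

Local Open Scope classical_set_scope.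
Local Open Scope ring_scope.
Local Open Scope complex_scope.

(* Write c_1, ..., c_n for the primaries.  They are the roots of X^n - c_1^n, so
   g'(w) = ((n-1)/n) (1 - c_1^n / w^n) vanishes simply at each c_j and |g'|^2 is
   dt/ds; moreover g(c_j) = c_j.  Hence g' = (w - c_j) S_j and
   g - c_j = (w - c_j)^2 T_j with S_j, T_j rational with poles only at 0 and
   T_j(c_j) != 0, and the singular quotient |g'|^2 / |g - c_j| in |g'|^2 V(g)
   equals |S_j|^2 / |T_j|, which is smooth at c_j.  In the kinetic terms the
   factor |g'|^2 cancels the denominators coming from Z = W / conj(g').
   That g covers a neighbourhood of c_j follows from root counting: for
   P = (n-1) X^n - n zeta X^(n-1) + c_1^n, whose roots are the preimages of zeta,
   P(c_j) = n c_j^(n-1) (c_j - zeta) is (n-1) times the product of the differences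
   between c_j and the roots, so one root is close to c_j when zeta is. *)

(** * Closure properties of real smooth functions *)

Section RealSmooth.
Context {R : realType} {V : normedModType R}.
Implicit Types (U : set V) (f g : V -> R) (k : nat).

(** Differentiability is local: the first-order expansion of [f] at [x] also serves for [g], and
    uniqueness identifies the differentials. *)
Lemma near_eq_differentiable f g (x : V) :
  {near x, f =1 g} -> differentiable f x -> differentiable g x.
Proof.
move=> fg df; have gx : f x = g x := nbhs_singleton fg.
have [dfc /eqaddoP dfo] := (diff_locallyP x f).1 df.
have dg : g \o shift x = cst (g x) + 'd f x +o_ (0 : V) id.
  apply/eqaddoP => e e0; have := dfo e e0.
  have : \forall h \near (0 : V), f (h + x) = g (h + x).
    by move: fg; rewrite [X in X -> _](near_shift 0) /= subr0.
  by apply: filterS2 => h /= fgh; rewrite !fctE /= /shift /= fgh gx.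
apply/diff_locallyP; rewrite (diff_unique dfc dg).
by split.
Qed.

Lemma class_C_subset k U U' f : U' `<=` U -> class_C k U f -> class_C k U' f.
Proof.
elim: k f => [|k IHk] f sU /=; first by move=> fU x /sU /fU.
by case=> fd fD; split=> [x /sU /fd //|v]; exact: IHk.
Qed.

(** Openness turns equality on [U] into equality near each of its points, so directional derivatives
    agree on [U] too. Derivative formulas valid only on [U] can then be substituted. *)
Lemma eq_class_C k U f g : open U -> {in U, f =1 g} ->
  class_C k U f -> class_C k U g.
Proof.
move=> oU; elim: k f g => [|k IHk] f g fg.
  move=> fc x Ux; have nfg : {near x, f =1 g}.
    by apply: filterS (open_nbhs_nbhs (conj oU Ux)) => y Uy; rewrite fg ?inE.
  rewrite /prop_for /continuous_at -(nbhs_singleton nfg).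
  by apply: cvg_trans (fc x Ux); exact: near_eq_cvg.
have nfg x : U x -> {near x, f =1 g}.
  move=> Ux; apply: filterS (open_nbhs_nbhs (conj oU Ux)) => y Uy.
  by rewrite fg ?inE.
move=> [fd fD]; split=> [x Ux|v].
  exact: near_eq_differentiable (nfg x Ux) (fd x Ux).
by apply: IHk (fD v) => x /[1!inE] /nfg; exact: near_eq_derive.
Qed.

Lemma class_CS k U f : class_C k.+1 U f -> class_C k U f.
Proof.
elim: k f => [|k IHk] f /=; case=> fd fD.
  by move=> x /fd; exact: differentiable_continuous.
by split=> // v; exact: IHk (fD v).
Qed.

Lemma class_C_cst k U (c : R) : class_C k U (fun=> c).
Proof.
elim: k c => [|k IHk] c /=; first by move=> x _; exact: cst_continuous.
split=> [x _|v]; first exact: differentiable_cst.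
suff -> : (fun x => 'D_v (fun=> c) x) = (fun=> 0) :> (V -> R) by exact: IHk.
by apply/funext => x; exact: derive_cst.
Qed.

Lemma class_CD k U f g : open U -> class_C k U f -> class_C k U g ->
  class_C k U (fun x => f x + g x).
Proof.
move=> oU; elim: k f g => [|k IHk] f g /=.
  by move=> fc gc x Ux; apply: continuousD; [exact: fc|exact: gc].
move=> [fd fD] [gd gD]; split=> [x Ux|v].
  by apply: differentiableD; [exact: fd|exact: gd].
apply: eq_class_C (IHk _ _ (fD v) (gD v)) => // x; rewrite inE => Ux.
by rewrite -deriveD//; apply: diff_derivable; [exact: fd|exact: gd].
Qed.

(** By the Leibniz rule the derivative is again a sum of products; [class_CS] lowers the
    undifferentiated factors to order [k]. *)
Lemma class_CM k U f g : open U -> class_C k U f -> class_C k U g ->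
  class_C k U (fun x => f x * g x).
Proof.
move=> oU; elim: k f g => [|k IHk] f g.
  by move=> fc gc x Ux; apply: continuousM; [exact: fc|exact: gc].
move=> fC gC; move: (fC) (gC) => /= [fd fD] [gd gD]; split=> [x Ux|v].
  by apply: differentiableM; [exact: fd|exact: gd].
apply: eq_class_C (class_CD _ _ _ _ oU (IHk _ _ (class_CS _ _ _ fC) (gD v))
  (IHk _ _ (class_CS _ _ _ gC) (fD v))) => // x; rewrite inE => Ux.
by rewrite deriveM//; apply: diff_derivable; [exact: fd|exact: gd].
Qed.

(** The derivative [- f^-2 * D f] contains the inverse itself only at one order lower, where the
    induction hypothesis applies. *)
Lemma class_CV k U f : open U -> (forall x, U x -> f x != 0) ->
  class_C k U f -> class_C k U (fun x => (f x)^-1).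
Proof.
move=> oU f0; elim: k => [|k IHk].
  by move=> fc x Ux; apply: continuousV; [exact: f0|exact: fc].
move=> fC; move: (fC) => /= [fd fD]; split=> [x Ux|v].
  by apply: differentiableV; [exact: fd|exact: f0].
have VC := IHk (class_CS _ _ _ fC).
apply: eq_class_C (class_CM _ _ _ _ oU (class_C_cst _ _ (-1))
  (class_CM _ _ _ _ oU (class_CM _ _ _ _ oU VC VC) (fD v))) => // x.
rewrite inE => Ux; rewrite (deriveV (f0 x Ux) (diff_derivable (fd x Ux))).
by rewrite mulN1r -invfM -expr2 -scaleNr.
Qed.

Lemma class_C_sqrt k U f : open U -> (forall x, U x -> 0 < f x) ->
  class_C k U f -> class_C k U (fun x => Num.sqrt (f x)).
Proof.
move=> oU f0; elim: k => [|k IHk].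
  move=> fc x Ux; apply: continuous_comp; first exact: fc.
  exact: sqrt_continuous.
move=> fC; move: (fC) => /= [fd fD].
have sd x : U x -> differentiable (fun x => Num.sqrt (f x)) x.
  move=> Ux; apply: differentiable_comp; first exact: fd.
  by apply/derivable1_diffP; have [] := is_derive1_sqrt (f0 _ Ux).
split=> // v.
have sC := IHk (class_CS _ _ _ fC).
have s0 x : U x -> 2 * Num.sqrt (f x) != 0.
  by move=> /f0 fx; rewrite mulf_neq0// gt_eqF// sqrtr_gt0.
apply: eq_class_C (class_CM _ _ _ _ oU (class_CV _ _ _ oU s0
  (class_CM _ _ _ _ oU (class_C_cst _ _ 2) sC)) (fD v)) => // x.
rewrite inE => Ux.
have ds : derivable _ x v := diff_derivable (sd x Ux).
(* The Leibniz rule for [f = sqrt f * sqrt f] gives [D f = 2 * sqrt f * D (sqrt f)], which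
   determines the derivative of the root. *)
have fE : \forall y \near x, f y = (fun x => Num.sqrt (f x) * Num.sqrt (f x)) y.
  have := open_nbhs_nbhs (conj oU Ux); apply: filterS => y Uy.
  by rewrite -expr2 sqr_sqrtr// ltW// f0.
rewrite (near_eq_derive _ fE) (deriveM ds ds); apply: (mulfI (s0 x Ux)).
by rewrite mulVKf ?s0// mulr_natl mulr2n mulrDl.
Qed.

End RealSmooth.

(** * Smooth complex-valued functions *)

Section Modulus.
Context {R : realType}.
Implicit Types x y : R[i].

Lemma cabsC x : (cabs x)%:C = `|x|.
Proof. by rewrite /cabs normc_def. Qed.

Lemma cabsE x : cabs x = Num.sqrt (complex.Re x ^+ 2 + complex.Im x ^+ 2).
Proof. by rewrite /cabs normc_def. Qed.

Lemma cabs_ge0 x : 0 <= cabs x.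
Proof. by rewrite cabsE sqrtr_ge0. Qed.

Lemma sqr_cabs x : cabs x ^+ 2 = complex.Re x ^+ 2 + complex.Im x ^+ 2.
Proof. by rewrite cabsE sqr_sqrtr// addr_ge0// sqr_ge0. Qed.

Lemma cabs_eq0 x : (cabs x == 0) = (x == 0).
Proof. by rewrite -(inj_eq (@complexI R)) cabsC normr_eq0. Qed.

Lemma cabsM x y : cabs (x * y) = cabs x * cabs y.
Proof. by apply: (@complexI R); rewrite rmorphM/= !cabsC normrM. Qed.

Lemma cabsV x : cabs x^-1 = (cabs x)^-1.
Proof. by apply: (@complexI R); rewrite fmorphV/= !cabsC normfV. Qed.

Lemma cabsX x m : cabs (x ^+ m) = cabs x ^+ m.
Proof. by apply: (@complexI R); rewrite rmorphXn/= !cabsC normrX. Qed.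

Lemma cabsN x : cabs (- x) = cabs x.
Proof. by apply: (@complexI R); rewrite !cabsC normrN. Qed.

Lemma cabs_conjc x : cabs (x^*)%C = cabs x.
Proof. by rewrite !cabsE; case: x => a b /=; rewrite sqrrN. Qed.

Lemma cabs_real (a : R) : cabs a%:C = `|a|.
Proof. by rewrite cabsE /= expr0n addr0 sqrtr_sqr. Qed.

Lemma cabs_prod (I : Type) (s : seq I) (P : pred I) (F : I -> R[i]) :
  cabs (\prod_(i <- s | P i) F i) = \prod_(i <- s | P i) cabs (F i).
Proof.
apply: (big_morph _ cabsM).
by apply: (@complexI R); rewrite cabsC normr1.
Qed.

End Modulus.

Section Smooth.
Context {R : realType} {V : normedModType R}.
Implicit Types (U : set V) (f g : V -> R) (F G : V -> R[i]).

Definition csmooth_on U F : Prop :=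
  smooth_on U (fun x => complex.Re (F x)) /\
  smooth_on U (fun x => complex.Im (F x)).

Lemma class_C_linear k U (f : {linear V -> R}) : continuous f -> class_C k U f.
Proof.
move=> fc; case: k => [|k]; first by move=> x _; exact: fc.
split=> [x _|v]; first exact: linear_differentiable.
suff -> : 'D_v f = fun=> f v by exact: class_C_cst.
apply/funext => x; have fd : differentiable f x by exact: linear_differentiable.
by rewrite deriveE// diff_lin.
Qed.

Lemma smooth_on_subset U U' f : U' `<=` U -> smooth_on U f -> smooth_on U' f.
Proof. by move=> sU fs k; exact: class_C_subset (fs k). Qed.

Lemma csmooth_on_cst U (c : R[i]) : csmooth_on U (fun=> c).
Proof. by split=> k; exact: class_C_cst. Qed.

Lemma csmooth_on_real U f : smooth_on U f -> csmooth_on U (fun x => (f x)%:C).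
Proof. by move=> fs; split=> //= k; exact: class_C_cst. Qed.

Section Closure.
Context {U : set V} (oU : open U).

Lemma smooth_onD f g : smooth_on U f -> smooth_on U g ->
  smooth_on U (fun x => f x + g x).
Proof. by move=> fs gs k; exact: class_CD. Qed.

Lemma smooth_onM f g : smooth_on U f -> smooth_on U g ->
  smooth_on U (fun x => f x * g x).
Proof. by move=> fs gs k; exact: class_CM. Qed.

Lemma smooth_onN f : smooth_on U f -> smooth_on U (fun x => - f x).
Proof.
move=> fs; under [X in smooth_on _ X]eq_fun do rewrite -mulN1r.
by apply: smooth_onM => // k; exact: class_C_cst.
Qed.

Lemma smooth_onB f g : smooth_on U f -> smooth_on U g ->
  smooth_on U (fun x => f x - g x).
Proof. by move=> fs gs; apply: smooth_onD => //; exact: smooth_onN. Qed.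

Lemma smooth_onX f m : smooth_on U f -> smooth_on U (fun x => f x ^+ m).
Proof.
move=> fs; elim: m => [|m IHm].
  by under [X in smooth_on _ X]eq_fun do rewrite expr0; move=> k;
    exact: class_C_cst.
by under [X in smooth_on _ X]eq_fun do rewrite exprS; exact: smooth_onM.
Qed.

Lemma smooth_onV f : (forall x, U x -> f x != 0) ->
  smooth_on U f -> smooth_on U (fun x => (f x)^-1).
Proof. by move=> f0 fs k; exact: class_CV. Qed.

Lemma smooth_on_sum (I : eqType) (s : seq I) (f : I -> V -> R) :
  (forall i, i \in s -> smooth_on U (f i)) ->
  smooth_on U (fun x => \sum_(i <- s) f i x).
Proof.
elim: s => [|i s IHs] fs.
  under [X in smooth_on _ X]eq_fun do rewrite big_nil.
  by move=> k; exact: class_C_cst.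
under [X in smooth_on _ X]eq_fun do rewrite big_cons.
apply: smooth_onD; first by apply: fs; rewrite mem_head.
by apply: IHs => j js; apply: fs; rewrite inE js orbT.
Qed.

Lemma csmooth_onD F G : csmooth_on U F -> csmooth_on U G ->
  csmooth_on U (fun x => F x + G x).
Proof.
by move=> [F1 F2] [G1 G2]; split;
  under [X in smooth_on _ X]eq_fun do rewrite raddfD; exact: smooth_onD.
Qed.

Lemma csmooth_onN F : csmooth_on U F -> csmooth_on U (fun x => - F x).
Proof.
by move=> [F1 F2]; split;
  under [X in smooth_on _ X]eq_fun do rewrite raddfN; exact: smooth_onN.
Qed.

Lemma csmooth_onB F G : csmooth_on U F -> csmooth_on U G ->
  csmooth_on U (fun x => F x - G x).
Proof. by move=> Fs Gs; apply: csmooth_onD => //; exact: csmooth_onN. Qed.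

Lemma csmooth_onM F G : csmooth_on U F -> csmooth_on U G ->
  csmooth_on U (fun x => F x * G x).
Proof.
have ReM (a b : R[i]) : complex.Re (a * b) =
    complex.Re a * complex.Re b - complex.Im a * complex.Im b.
  by case: a b => [? ?] [? ?].
have ImM (a b : R[i]) : complex.Im (a * b) =
    complex.Re a * complex.Im b + complex.Im a * complex.Re b.
  by case: a b => [? ?] [? ?].
move=> [F1 F2] [G1 G2]; split;
  under [X in smooth_on _ X]eq_fun do rewrite ?ReM ?ImM.
  by apply: smooth_onB; exact: smooth_onM.
by apply: smooth_onD; exact: smooth_onM.
Qed.

Lemma csmooth_on_conjc F : csmooth_on U F -> csmooth_on U (fun x => (F x)^*%C).
Proof.
have ReJ (a : R[i]) : complex.Re a^*%C = complex.Re a by case: a.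
have ImJ (a : R[i]) : complex.Im a^*%C = - complex.Im a by case: a.
move=> [F1 F2]; split;
  under [X in smooth_on _ X]eq_fun do rewrite ?ReJ ?ImJ; first by [].
exact: smooth_onN.
Qed.

Lemma smooth_on_sqr_cabs F :
  csmooth_on U F -> smooth_on U (fun x => cabs (F x) ^+ 2).
Proof.
move=> [F1 F2]; under [X in smooth_on _ X]eq_fun do rewrite sqr_cabs.
by apply: smooth_onD; exact: smooth_onX.
Qed.

(** Away from the zeros of [F], the modulus is the square root of the positive smooth function
    [|F| ^ 2]. *)
Lemma smooth_on_cabs F : (forall x, U x -> F x != 0) ->
  csmooth_on U F -> smooth_on U (fun x => cabs (F x)).
Proof.
move=> F0 Fs; have E (a : R[i]) : cabs a = Num.sqrt (cabs a ^+ 2).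
  by rewrite sqrtr_sqr ger0_norm// cabs_ge0.
under [X in smooth_on _ X]eq_fun do rewrite E.
move=> k; apply: class_C_sqrt => //; last exact: smooth_on_sqr_cabs.
by move=> x /F0 Fx; rewrite exprn_gt0// lt0r cabs_eq0 Fx cabs_ge0.
Qed.

(** The identity [a^-1 = conj a / |a| ^ 2] reduces complex inversion to real inversion. *)
Lemma csmooth_onV F : (forall x, U x -> F x != 0) ->
  csmooth_on U F -> csmooth_on U (fun x => (F x)^-1).
Proof.
move=> F0 Fs; have E (a : R[i]) : a^-1 = ((cabs a ^+ 2)^-1)%:C * a^*%C.
  by rewrite invc_norm fmorphV rmorphXn/= cabsC.
under [X in csmooth_on _ X]eq_fun do rewrite E.
apply: csmooth_onM; last exact: csmooth_on_conjc.
apply: csmooth_on_real; apply: smooth_onV; last exact: smooth_on_sqr_cabs.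
by move=> x Ux; rewrite expf_neq0// cabs_eq0 F0.
Qed.

Lemma csmooth_onX F m : csmooth_on U F -> csmooth_on U (fun x => F x ^+ m).
Proof.
move=> Fs; elim: m => [|m IHm].
  under [X in csmooth_on _ X]eq_fun do rewrite expr0.
  exact: csmooth_on_cst.
by under [X in csmooth_on _ X]eq_fun do rewrite exprS; exact: csmooth_onM.
Qed.

Lemma csmooth_on_sum (I : Type) (s : seq I) (P : pred I) (F : I -> V -> R[i]) :
  (forall i, csmooth_on U (F i)) ->
  csmooth_on U (fun x => \sum_(i <- s | P i) F i x).
Proof.
move=> Fs; elim: s => [|i s IHs].
  under [X in csmooth_on _ X]eq_fun do rewrite big_nil.
  exact: csmooth_on_cst.
under [X in csmooth_on _ X]eq_fun do rewrite big_cons.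
by case: (P i) => //; exact: csmooth_onD.
Qed.

Lemma csmooth_on_prod (I : Type) (s : seq I) (P : pred I) (F : I -> V -> R[i]) :
  (forall i, csmooth_on U (F i)) ->
  csmooth_on U (fun x => \prod_(i <- s | P i) F i x).
Proof.
move=> Fs; elim: s => [|i s IHs].
  under [X in csmooth_on _ X]eq_fun do rewrite big_nil.
  exact: csmooth_on_cst.
under [X in csmooth_on _ X]eq_fun do rewrite big_cons.
by case: (P i) => //; exact: csmooth_onM.
Qed.

Lemma open_neq0 F : csmooth_on U F -> open (U `&` [set x | F x != 0]).
Proof.
move=> /smooth_on_sqr_cabs/(_ 0) Fc; rewrite openE => x [Ux Fx].
rewrite /interior; apply: filterI; first exact: open_nbhs_nbhs.
have /cvgr_gt : 0 < cabs (F x) ^+ 2.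
  by rewrite exprn_gt0// lt0r cabs_eq0 Fx cabs_ge0.
move=> /(_ _ _ _ _ (Fc x Ux)); apply: filterS => y /=; rewrite -cabs_eq0.
by apply: contraTneq => ->; rewrite expr0n ltxx.
Qed.

End Closure.
End Smooth.

(** * Position and momentum as smooth functions on phase space *)

Section Coordinates.
Context {R : realType}.

Lemma csmooth_on_position (U : set (phase R)) :
  csmooth_on U (fun x => toC x.1).
Proof.
split=> k.
  apply: (class_C_linear k U (fst \o fst)).
  by move=> x; apply: continuous_comp; exact: cvg_fst.
apply: (class_C_linear k U (snd \o fst)).
by move=> x; apply: continuous_comp; [exact: cvg_fst|exact: cvg_snd].
Qed.

Lemma csmooth_on_momentum (U : set (phase R)) :
  csmooth_on U (fun x => toC x.2).
Proof.
split=> k.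
  apply: (class_C_linear k U (fst \o snd)).
  by move=> x; apply: continuous_comp; [exact: cvg_snd|exact: cvg_fst].
apply: (class_C_linear k U (snd \o snd)).
by move=> x; apply: continuous_comp; exact: cvg_snd.
Qed.

End Coordinates.

(** * The primaries as roots of unity *)

Section Factor.
Context {K : comNzRingType}.
Implicit Types c w : K.

(** The inner sum is the quotient of [w ^ (i + 1) - c ^ (i + 1)] by [w - c]. *)
Definition fold_cofactor (m : nat) c w : K :=
  \sum_(i < m) w ^+ (m.-1 - i) * \sum_(l < i.+1) w ^+ (i - l) * c ^+ l.

Lemma fold_factor m c w :
  m%:R * w ^+ m.+1 - m.+1%:R * c * w ^+ m + c ^+ m.+1 =
  (w - c) ^+ 2 * fold_cofactor m c w.
Proof.
(* The first factor [w - c] comes from [m w^m (w - c) - c (w^m - c^m)]. *)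
transitivity ((w - c) * (m%:R * w ^+ m - c * \sum_(i < m) w ^+ (m.-1 - i) * c ^+ i)).
  by rewrite mulrBr [(w - c) * (c * _)]mulrCA -subrXX !exprS -natr1; ring.
rewrite expr2 -mulrA; congr (_ * _); rewrite /fold_cofactor mulr_sumr mulr_sumr.
(* For the second factor, [m w^m] is spread over the [m] terms of the sum; each difference
   [w^m - w^(m-1-i) c^(i+1)] is divisible by [w - c]. *)
rewrite mulr_natl -[m in _ *+ m]card_ord -sumr_const -sumrB.
apply: eq_bigr => i _. rewrite [in RHS]mulrCA -(subrXX w c i.+1) mulrBr -exprD [c ^+ i.+1]exprS.
have -> : (m.-1 - i + i.+1)%N = m by case: m i => [[]//|m] [i /= ?]; rewrite addnS subnK.
by congr (_ - _); ring.
Qed.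

(** This is half the second derivative at the double root; its being nonzero shows that the root is
    exactly double. *)
Lemma fold_cofactor_diag m c :
  fold_cofactor m c c = (\sum_(i < m) i.+1)%:R * c ^+ m.-1.
Proof.
rewrite /fold_cofactor natr_sum mulr_suml; apply: eq_bigr => i _.
rewrite (eq_bigr (fun=> c ^+ i)) => [|l _]; last first.
  by rewrite -exprD subnK// -ltnS.
rewrite sumr_const card_ord mulrnAr -exprD mulr_natl subnK//.
by case: m i => [[]//|m] [].
Qed.

End Factor.

Section Roots.
Context {R : realType}.
Variables (n : nat).
Hypothesis n0 : (0 < n)%N.

Let theta : R := 2 * pi / n%:R.

(** De Moivre's formula. *)
Lemma root_of_unityX k : (cos theta +i* sin theta) ^+ k =
  cos (k%:R * theta) +i* sin (k%:R * theta).
Proof.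
elim: k => [|k IHk]; first by rewrite mul0r cos0 sin0.
rewrite exprS IHk -natr1 mulrDl mul1r addrC cosD sinD.
by congr (_ +i* _); ring.
Qed.

Lemma root_of_unity_prim : n.-primitive_root (cos theta +i* sin theta).
Proof.
have nR : n%:R != 0 :> R by rewrite pnatr_eq0 -lt0n.
rewrite /primitive_root_of_unity n0; apply/forallP => i.
rewrite unity_rootE root_of_unityX; apply/eqP; apply/eqP/eqP => [|->]; last first.
  by rewrite /theta mulrCA divff// mulr1 mulrC mulr_natr cos2pi sin2pi.
move=> [cos1 _]; apply/eqP; rewrite eqn_leq ltn_ord /= leqNgt.
apply/negP => lt_in.
(* Half the angle. A cosine equal to 1 at the full angle forces [sin x = 0], whereas [0 < x < pi]
   when [i + 1 < n]. *)
pose x : R := i.+1%:R * pi / n%:R.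
have xE : i.+1%:R * theta = x *+ 2 by rewrite /theta /x -mulr_natl; ring.
have : 0 < sin x.
  apply: sin_gt0_pi; rewrite /x.
  rewrite divr_gt0 ?mulr_gt0 ?pi_gt0 ?ltr0n//=.
  by rewrite ltr_pdivrMr ?ltr0n// mulrC ltr_pM2l ?pi_gt0// ltr_nat.
suff /eqP -> : sin x == 0 by rewrite ltxx.
move: cos1; rewrite xE cos_mulr2n => cos1.
by rewrite -sqrf_eq0; apply/eqP; have := cos2Dsin2 x; lra.
Qed.
End Roots.

Section Primaries.
Context {R : realType}.
Variables (sigma : R) (n : nat) (r z : R).
Hypotheses (hn : (2 <= n)%N) (hr : 0 < r) (hz : z != 0).
Hypothesis hsurf : r ^+ 2 + sigma * z ^+ 2 = sigma.

(** The surface equation factors as [r^2 = sigma (1 + z) (1 - z)], with a nonzero left side. These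
    are the denominators of the primaries and the antipodes. *)
Lemma height_neq1 : 1 + z != 0 /\ 1 - z != 0.
Proof.
have r2 : r ^+ 2 != 0 by rewrite expf_neq0// gt_eqF.
have r2E : r ^+ 2 = sigma * (1 + z) * (1 - z).
  have -> : r ^+ 2 = sigma - sigma * z ^+ 2 by apply/eqP; rewrite eq_sym subr_eq hsurf.
  by ring.
by split; apply: contra_neq r2; rewrite r2E => ->; rewrite mulr0 ?mul0r.
Qed.

Lemma circle_pointE j : (1 <= j)%N -> kk n r j +i* hh n r j =
  r%:C * (cos (2 * pi / n%:R) +i* sin (2 * pi / n%:R)) ^+ j.-1.
Proof.
case: j => // j _; rewrite root_of_unityX /kk /hh -(natr1 j) addrK /=.
have -> : 2 * pi * j%:R / n%:R = j%:R * (2 * pi / n%:R) :> R by ring.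
by simpc.
Qed.

Lemma primaryE j : (1 <= j)%N -> primary n r z j =
  primary n r z 1 * (cos (2 * pi / n%:R) +i* sin (2 * pi / n%:R)) ^+ j.-1.
Proof. by move=> j1; rewrite /primary !circle_pointE//= expr0 mulr1 mulrAC. Qed.

Lemma primary_expr j : (1 <= j)%N -> primary n r z j ^+ n = primary n r z 1 ^+ n.
Proof.
move=> j1; rewrite primaryE// exprMn -exprM mulnC exprM.
by rewrite (prim_expr_order (root_of_unity_prim n (ltnW hn))) expr1n mulr1.
Qed.

Lemma cabs_circle_point j : cabs (kk n r j +i* hh n r j) = r.
Proof.
rewrite cabsE /= /kk /hh !exprMn -mulrDr cos2Dsin2 mulr1 sqrtr_sqr.
by rewrite gtr0_norm.
Qed.

Lemma cabs_primary j : cabs (primary n r z j) = r / `|1 + z|.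
Proof. by rewrite cabsM cabsV cabs_circle_point cabs_real. Qed.

Lemma primary_neq0 j : primary n r z j != 0.
Proof.
rewrite -cabs_eq0 cabs_primary mulf_neq0 ?gt_eqF// invr_gt0 normr_gt0.
exact: height_neq1.1.
Qed.

(** The moduli are [r / |1 + z|] and [r / |1 - z|]; their equality would give
    [(1 + z)^2 = (1 - z)^2], hence [z = 0]. *)
Lemma primary_neq_antipode j k : primary n r z j != antipode n r z k.
Proof.
have [z1 z2] := height_neq1.
apply/eqP => /(congr1 (@cabs R)); rewrite cabs_primary cabsN cabsM cabsV.
rewrite cabs_circle_point cabs_real => /(mulfI (lt0r_neq0 hr)).
move=> /invr_inj /(congr1 (fun x => x ^+ 2)); rewrite !real_normK ?num_real//.
by apply/eqP; apply: contraNneq hz => E; apply/eqP; lra.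
Qed.

(** The factorization of [X^n - 1] over the powers of a primitive root, evaluated at [w / c] and
    multiplied by [c^n]. *)
Lemma prod_sub_primary (w : R[i]) :
  \prod_(1 <= j < n.+1) (w - primary n r z j) = w ^+ n - primary n r z 1 ^+ n.
Proof.
set c := primary n r z 1; have c0 : c != 0 := primary_neq0 1.
have := factor_Xn_sub_1 (root_of_unity_prim (R := R) n (ltnW hn)).
move=> /(congr1 (fun p => c ^+ n * p.[w / c])).
rewrite !hornerE mulrBr mulr1 -exprMn mulrCA divff// mulr1 => <-.
rewrite horner_prod big_add1 /= !big_mkord.
rewrite -[n in _ ^+ n]card_ord -prodr_const -big_split /=.
apply: eq_bigr => i _; by rewrite !hornerE primaryE//= mulrBr mulrCA divff// mulr1.
Qed.

End Primaries.

(** * The covering map near the primaries *)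

Lemma is_derive_affine_inv (K : numFieldType) (A B N : K) (m : nat) (w : K) :
  N * w ^+ m != 0 ->
  is_derive (w : K^o) 1 (fun x : K^o => A * x + B / (N * x ^+ m) : K^o)
    (A - B * (N * (m%:R * w ^+ m.-1)) / (N * w ^+ m) ^+ 2).
Proof.
move=> w0.
have dX : is_derive (w : K^o) 1 (fun x : K^o => N * x ^+ m : K^o)
    (N * (m%:R * w ^+ m.-1)).
  have dX : derivable (fun x : K^o => x ^+ m) (w : K^o) 1
    by exact: exprn_derivable.
  apply: DeriveDef; first exact: (derivableZ (k := N) dX).
  have := deriveZ N dX; rewrite exp_derive => ->.
  by rewrite /GRing.scale /= mulr1.
have dV : is_derive (w : K^o) 1 (fun x : K^o => (N * x ^+ m)^-1 : K^o)
    (- (N * (m%:R * w ^+ m.-1)) / (N * w ^+ m) ^+ 2).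
  case: dX => d1 d2; apply: DeriveDef; first exact: derivableV.
  by rewrite deriveV// d2 /GRing.scale /= mulrC mulNr mulrN.
have dI : is_derive (w : K^o) 1 (fun x : K^o => A * x : K^o) (A *: 1).
  exact: (is_deriveZ A (is_derive_id w 1)).
apply: (is_derive_eq (is_deriveD dI (is_deriveZ B dV))).
by rewrite /GRing.scale /= mulr1 mulNr mulrN mulrA.
Qed.

Section CoveringMap.
Context {R : realType}.
Variables (n : nat) (r z : R).
Hypothesis hn : (2 <= n)%N.
Implicit Types c w zeta : R[i].

Local Notation g := (g_map n r z).

Definition g_deriv w : R[i] :=
  (n%:R - 1) / n%:R * (1 - primary n r z 1 ^+ n / w ^+ n).

(* T_c and S_c, in the sense of g - c = (w - c)^2 T_c and g' = (w - c) S_c, for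
   any c with c^n = c_1^n. *)
Definition fold_value c w : R[i] :=
  fold_cofactor n.-1 c w / (n%:R * w ^+ n.-1).

Definition fold_slope c w : R[i] :=
  (n%:R - 1) / n%:R * (\sum_(i < n) w ^+ (n.-1 - i) * c ^+ i) / w ^+ n.

Let nC : n%:R != 0 :> R[i].
Proof. by rewrite pnatr_eq0 -lt0n ltnW. Qed.

Let n1C : n%:R - 1 != 0 :> R[i].
Proof. by rewrite subr_eq0 -[1]/(1%:R) eqr_nat gtn_eqF. Qed.

Let predn1 : n%:R - 1 = n.-1%:R :> R[i].
Proof. by apply/eqP; rewrite subr_eq natr1 prednK// ltnW. Qed.

(** Multiplied by [n w^(n-1)], the left side becomes [(n-1) w^n - n c w^(n-1) + c^n], which is
    [fold_factor] with [m = n - 1]. *)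
Lemma g_map_sub c w : w != 0 -> c ^+ n = primary n r z 1 ^+ n ->
  g w - c = (w - c) ^+ 2 * fold_value c w.
Proof.
move=> w0 cn; rewrite /fold_value mulrA -fold_factor prednK ?(ltnW hn)//.
rewrite /g_map -cn predn1 -[in w ^+ n](prednK (ltnW hn)) exprS.
have wn : w ^+ n.-1 != 0 by rewrite expf_neq0.
by field; rewrite wn nC.
Qed.

Lemma g_deriv_factor c w : w != 0 -> c ^+ n = primary n r z 1 ^+ n ->
  g_deriv w = (w - c) * fold_slope c w.
Proof.
move=> w0 cn; rewrite /g_deriv /fold_slope -cn.
have wn : w ^+ n != 0 by rewrite expf_neq0.
have := subrXX w c n; set S := \sum_(_ < _) _ => E.
have -> : 1 - c ^+ n / w ^+ n = (w ^+ n - c ^+ n) / w ^+ n.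
  by rewrite mulrBl divff.
by rewrite E; ring.
Qed.

Lemma g_deriv_neq0 w : w != 0 -> w ^+ n != primary n r z 1 ^+ n ->
  g_deriv w != 0.
Proof.
move=> w0 wn; have wn0 : w ^+ n != 0 by rewrite expf_neq0.
have An : (n%:R - 1) / n%:R != 0 :> R[i] by rewrite mulf_neq0 ?invr_neq0.
rewrite /g_deriv; apply: mulf_neq0 => //; rewrite subr_eq0 eq_sym.
by apply: contra_neq wn => /divr1_eq.
Qed.

(** Where [g w != c], the value is a factor of the nonzero [g w - c]; at [w = c] the diagonal
    formula applies. At any other nonzero preimage of [c] it vanishes, hence the disjunction. *)
Lemma fold_value_neq0 c w : w != 0 -> c != 0 -> c ^+ n = primary n r z 1 ^+ n ->
  w = c \/ g w != c -> fold_value c w != 0.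
Proof.
move=> w0 c0 cn [->|gwc]; last first.
  by move: gwc; rewrite -subr_eq0 g_map_sub// mulf_eq0 negb_or => /andP[].
rewrite mulf_neq0 ?invr_neq0 ?mulf_neq0 ?expf_neq0// fold_cofactor_diag.
rewrite mulf_neq0 ?expf_neq0// pnatr_eq0 -lt0n.
by case: n hn => [|[|m]] // _; rewrite big_ord_recl.
Qed.

Lemma g_map_fixed c : c != 0 -> c ^+ n = primary n r z 1 ^+ n -> g c = c.
Proof.
by move=> c0 cn; apply/eqP; rewrite -subr_eq0 g_map_sub// subrr expr0n mul0r.
Qed.

Lemma is_derive_g_map w : w != 0 ->
  is_derive (w : R[i]^o) 1 (g : R[i]^o -> R[i]^o) (g_deriv w).
Proof.
move=> w0; have w0n : n%:R * w ^+ n.-1 != 0 by rewrite mulf_neq0// expf_neq0.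
apply: is_derive_eq; first exact: (is_derive_affine_inv R[i] _ _ _ _ _ w0n).
rewrite /g_deriv predn1; set a := primary n r z 1 ^+ n.
(* The exponents [n.-1] and [n.-1.-1] become honest successors or variables, so that [field] can
   relate the powers of [w]. *)
have [m nE] : exists m, n = m.+2 by case: n hn => [|[|m]] // _; exists m.
move: nC; rewrite nE /= !exprS => n0.
have wm : w ^+ m != 0 by rewrite expf_neq0.
by field; rewrite wm w0 -natrD add2n.
Qed.

Lemma cderive_g_map w : w != 0 -> cderive g w = g_deriv w.
Proof.
by move=> /is_derive_g_map dg; rewrite /cderive derive1E; exact: derive_val.
Qed.

(** * Local surjectivity by counting roots *)

Lemma expr_le_prod_norm (e c : R[i]) (s : seq R[i]) : 0 <= e ->
  (forall w, w \in s -> e <= `|c - w|) ->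
  e ^+ size s <= \prod_(w <- s) `|c - w|.
Proof.
move=> e0; elim: s => [|w s IHs] far; first by rewrite big_nil.
rewrite big_cons exprS ler_pM ?exprn_ge0//; first by rewrite far// mem_head.
by apply: IHs => v vs; rewrite far// inE vs orbT.
Qed.

(** Since [g'] vanishes at [c], the inverse function theorem does not apply; a preimage of [zeta]
    near [c] is found among the roots of a polynomial instead. *)
Lemma g_map_covers c (N : set R[i]) : c != 0 -> c ^+ n = primary n r z 1 ^+ n ->
  nbhs (c : R[i]^o) N -> nbhs (c : R[i]^o) (g @` N).
Proof.
move=> c0 cn /nbhs_ballP[e /= e0 eN].
have n1_gt0 : 0 < n%:R - 1 :> R[i] by rewrite predn1 ltr0n -ltnS prednK// ltnW.
have n_gt0 : 0 < n%:R :> R[i] by rewrite ltr0n ltnW.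
(* Chosen so that [|c - zeta| < d] means [n |c|^(n-1) |c - zeta| < (n-1) e^n], whose left side will
   be [|p(c)|]. *)
pose d : R[i] := (n%:R - 1) * e ^+ n / (n%:R * `|c| ^+ n.-1).
have cn_gt0 : 0 < n%:R * `|c| ^+ n.-1 by rewrite mulr_gt0// exprn_gt0// normr_gt0.
have d0 : 0 < d by rewrite divr_gt0// mulr_gt0// exprn_gt0.
apply/nbhs_ballP; exists d => //= zeta; rewrite /ball /= => zd.
(* For nonzero [w], [p(w) = n w^(n-1) (g w - zeta)]; moreover [p(0) = c^n] is nonzero, so every root
   is a preimage of [zeta]. *)
pose p : {poly R[i]} := (n%:R - 1) *: 'X^n - (n%:R * zeta) *: 'X^(n.-1) + (c ^+ n)%:P.
have pE w : p.[w] = (n%:R - 1) * w ^+ n - n%:R * zeta * w ^+ n.-1 + c ^+ n.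
  by rewrite /p !hornerE.
have sz1 : (size (- ((n%:R * zeta) *: 'X^(n.-1)) + (c ^+ n)%:P)%R <= n)%N.
  rewrite (leq_trans (size_polyD _ _))// geq_max size_polyN; apply/andP; split.
    by rewrite (leq_trans (size_scale_leq _ _))// size_polyXn prednK// ltnW.
  by rewrite (leq_trans (size_polyC_leq1 _))// ltnW.
have szn : size ((n%:R - 1) *: 'X^n : {poly R[i]}) = n.+1.
  by rewrite size_scale// size_polyXn.
have szp : size p = n.+1 by rewrite /p -addrA size_polyDl szn.
have lcp : lead_coef p = n%:R - 1.
  by rewrite /p -addrA lead_coefDl ?szn// lead_coefZ lead_coefXn mulr1.
have exprE (w : R[i]) : w ^+ n = w * w ^+ n.-1.
  by rewrite -exprS prednK// ltnW.
have [rs prs] := closed_field_poly_normal p.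
have szrs : size rs = n.
  have := congr1 (fun q : {poly R[i]} => size q) prs.
  by rewrite lcp size_scale// size_prod_XsubC szp => -[].
have [/hasP[w wrs cw]|/hasPn far] := boolP (has (fun w => `|c - w| < e) rs).
  have /eqP pw : root p w.
    by rewrite prs rootZ ?lcp// root_prod_XsubC.
  have w0 : w != 0.
    apply/eqP => w0; move: pw; rewrite pE w0 !expr0n.
    case: (n) hn => [|[|m]] // _ /=; rewrite !mulr0 subr0 add0r => /eqP.
    by rewrite expf_eq0 (negPf c0) andbF.
  exists w; first by apply: eN.
  move: pw; rewrite pE /g_map -cn exprE => pw.
  have wn : w ^+ n.-1 != 0 by rewrite expf_neq0.
  have cE : c ^+ n = n%:R * zeta * w ^+ n.-1 - (n%:R - 1) * (w * w ^+ n.-1).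
    by apply/eqP; rewrite -subr_eq0 -pw; apply/eqP; ring.
  by rewrite cE; field; rewrite wn nC.
(* If all [n] roots were at distance at least [e] from [c], this bound would give
   [d <= |c - zeta|]. *)
have : (n%:R - 1) * e ^+ n <= `|p.[c]|.
  rewrite {1}prs lcp hornerZ normrM gtr0_norm// ler_pM2l//.
  rewrite horner_prod normr_prod -szrs.
  under eq_bigr do rewrite !hornerE.
  apply: expr_le_prod_norm => [|w /far]; first exact: ltW.
  (* The order on [R[i]] is partial, so negating the strict inequality requires both sides to be
     real. *)
  by rewrite real_ltNge ?negbK// ?normr_real// gtr0_real.
have -> : p.[c] = n%:R * c ^+ n.-1 * (c - zeta) by rewrite pE !exprE; ring.
rewrite normrM normrM normrX normr_nat -ler_pdivrMl// mulrC -/d => dz.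
by have := le_lt_trans dz zd; rewrite ltxx.
Qed.

End CoveringMap.

(** * The regularized Hamiltonian *)

Section Extension.
Context {R : realType}.
Variables (sigma : R) (n : nat) (r z Omega : R).
Hypothesis hn : (2 <= n)%N.
Hypotheses (hr : 0 < r) (hz : z != 0).
Hypothesis hsurf : r ^+ 2 + sigma * z ^+ 2 = sigma.
Implicit Types w W : R[i].

Local Notation g := (g_map n r z).
Local Notation c_ := (primary n r z).
Local Notation a_ := (antipode n r z).

Definition potential_numerator (j : nat) (zeta : R[i]) : R :=
  complex.Re ((kk n r j)%:C * (zeta + (zeta^*)%C)
              - ('i)%C * (hh n r j)%:C * (zeta - (zeta^*)%C)
              + (sigma * z * (1 - sigma * cabs zeta ^+ 2))%:C).

(* |g'|^2 V(g) with |g'|^2 / |g - c_j| rewritten as |S_j|^2 / |T_j|. *)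
Definition regularized_potential w : R :=
  \sum_(1 <= j < n.+1)
    potential_numerator j (g w) *
    (cabs (fold_slope n (c_ j) w) ^+ 2 / cabs (fold_value n (c_ j) w)) /
    (r * cabs (g w - a_ j)).

(** The transformed Hamiltonian after cancelling every quotient by [g'] or by [w - c_j]; the formula
    remains meaningful at [w = c_j]. *)
Definition regularized_hamiltonian (C : R) w W : R :=
  (1 + sigma * cabs (g w) ^+ 2) ^+ 2 / 4 * cabs W ^+ 2
  + 2 * Omega * complex.Im (g w * ((g_deriv n r z w)^* * W^*)%C)
  - 2 * regularized_potential w
  + cabs (g_deriv n r z w) ^+ 2 * (C / 2).

(** The zeros of [g'] are the primaries, and [g] fixes each of them, so [g w != c_j] already
    excludes [w = c_j]. *)
Lemma g_deriv_neq0_off_collision w : w != 0 ->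
  (forall j, (1 <= j <= n)%N -> g w != c_ j) -> g_deriv n r z w != 0.
Proof.
move=> w0 gc; apply: g_deriv_neq0 => //.
rewrite -subr_eq0 -(prod_sub_primary sigma n r z hn hr hsurf w) prodf_seq_neq0.
apply/allP => j; rewrite mem_index_iota ltnS /= => jn; rewrite subr_eq0.
apply: contra_neq (gc j jn) => ->; apply: g_map_fixed => //.
  exact: (primary_neq0 sigma n r z hr hsurf).
by apply: (primary_expr n r z hn); case/andP: jn.
Qed.

Lemma transformed_hamiltonianE C w W : w != 0 ->
  (forall j, (1 <= j <= n)%N -> g w != c_ j) ->
  transformed_hamiltonian (hamiltonian sigma n r z Omega) g C w W =
  regularized_hamiltonian C w W.
Proof.
move=> w0 gc; have d0 := g_deriv_neq0_off_collision w w0 gc.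
rewrite /transformed_hamiltonian cderive_g_map// /hamiltonian.
rewrite /regularized_hamiltonian !mulrDr !mulrN.
set d := g_deriv n r z w in d0 *.
have cd0 : cabs d != 0 by rewrite cabs_eq0.
congr (_ + _ - _ + _).
- rewrite cabsM cabsV cabs_conjc exprMn exprVn.
  by field.
(* In the rotation term [conj (W / conj g') = conj W / g'], and [|g'|^2 / g' = conj g']. *)
- rewrite rmorphM/= conjc_inv conjcK.
  have dd : (cabs d ^+ 2)%:C = d * (d^*)%C by rewrite rmorphXn/= cabsC sqr_normc.
  have -> : g w * ((d^*)%C * (W^*)%C) =
      (cabs d ^+ 2)%:C * (g w * ((W^*)%C / d)) by rewrite dd; field.
  by rewrite mulrCA; congr (_ * _); case: (g w * _) => x y; simpc.
- rewrite mulrCA; congr (_ * _); rewrite /potential mulr_sumr.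
  apply: eq_big_seq => j; rewrite mem_index_iota ltnS => jn.
  rewrite -/(potential_numerator j (g w)).
  have cn : c_ j ^+ n = c_ 1 ^+ n.
    by apply: (primary_expr n r z hn); case/andP: jn.
  have gE := g_map_sub n r z hn (c_ j) w w0 cn.
  have T0 : cabs (fold_value n (c_ j) w) != 0.
    rewrite cabs_eq0; have := gc j jn.
    by rewrite -subr_eq0 gE mulf_eq0 negb_or => /andP[].
  have w0c : cabs (w - c_ j) != 0.
    rewrite cabs_eq0; have := gc j jn.
    by rewrite -subr_eq0 gE mulf_eq0 expf_eq0 negb_or => /andP[].
  (* Both [|g'|^2] and [|g - c_j|] now carry the factor [|w - c_j|^2], which cancels. *)
  rewrite /d (g_deriv_factor n r z (c_ j))// gE; move: T0 w0c.
  generalize (potential_numerator j (g w)) (cabs (g w - a_ j)) => P Y.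
  generalize (fold_value n (c_ j) w) (fold_slope n (c_ j) w) (w - c_ j) => T S A.
  rewrite !cabsM [r * _ * _]mulrAC invfM.
  move: (cabs T) (cabs S) (cabs A) (r * Y)^-1 => {}T {}S {}A {}Y T0 A0.
  by field; rewrite T0 A0.
Qed.

(** An open set on which all remaining denominators are nonzero. Gathering these conditions into one
    product lets a single use of [open_neq0] inside the punctured domain prove openness. *)
Definition regular_domain : set (phase R) :=
  [set x | toC x.1 != 0] `&`
  [set x | \prod_(1 <= j < n.+1)
     (fold_value n (c_ j) (toC x.1) * (g (toC x.1) - a_ j)) != 0].

Lemma regular_domain_neq0 x j : regular_domain x -> (1 <= j <= n)%N ->
  fold_value n (c_ j) (toC x.1) != 0 /\ g (toC x.1) - a_ j != 0.
Proof.
move=> [_ /=]; rewrite prodf_seq_neq0 => /allP P jn.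
have /P : j \in index_iota 1 n.+1 by rewrite mem_index_iota ltnS.
by rewrite /= mulf_eq0 negb_or => /andP[].
Qed.

Lemma csmooth_on_g (U : set (phase R)) : open U ->
  (forall x, U x -> toC x.1 != 0) -> csmooth_on U (fun x => g (toC x.1)).
Proof.
move=> oU U0; apply: csmooth_onD => //; apply: csmooth_onM => //;
  try exact: csmooth_on_cst; first exact: csmooth_on_position.
apply: csmooth_onV => // [x Ux|].
  by rewrite mulf_neq0 ?expf_neq0 ?U0// pnatr_eq0 -lt0n ltnW.
apply: csmooth_onM => //; first exact: csmooth_on_cst.
by apply: csmooth_onX => //; exact: csmooth_on_position.
Qed.

Lemma csmooth_on_fold_value (U : set (phase R)) c : open U ->
  (forall x, U x -> toC x.1 != 0) ->
  csmooth_on U (fun x => fold_value n c (toC x.1)).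
Proof.
move=> oU U0; have ps := csmooth_on_position U.
apply: csmooth_onM => //; last first.
  apply: csmooth_onV => // [x Ux|].
    by rewrite mulf_neq0 ?expf_neq0 ?U0// pnatr_eq0 -lt0n ltnW.
  by apply: csmooth_onM => //; [exact: csmooth_on_cst|exact: csmooth_onX].
apply: csmooth_on_sum => // i; apply: csmooth_onM => //; first exact: csmooth_onX.
apply: csmooth_on_sum => // l; apply: csmooth_onM => //; first exact: csmooth_onX.
exact: csmooth_on_cst.
Qed.

Lemma csmooth_on_fold_slope (U : set (phase R)) c : open U ->
  (forall x, U x -> toC x.1 != 0) ->
  csmooth_on U (fun x => fold_slope n c (toC x.1)).
Proof.
move=> oU U0; have ps := csmooth_on_position U.
apply: csmooth_onM => //; last first.
  apply: csmooth_onV => // [x Ux|]; first by rewrite expf_neq0 ?U0.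
  exact: csmooth_onX.
apply: csmooth_onM => //; first exact: csmooth_on_cst.
apply: csmooth_on_sum => // i; apply: csmooth_onM => //; first exact: csmooth_onX.
exact: csmooth_on_cst.
Qed.

Lemma csmooth_on_g_deriv (U : set (phase R)) : open U ->
  (forall x, U x -> toC x.1 != 0) ->
  csmooth_on U (fun x => g_deriv n r z (toC x.1)).
Proof.
move=> oU U0; have ps := csmooth_on_position U.
apply: csmooth_onM => //; first exact: csmooth_on_cst.
apply: csmooth_onB => //; first exact: csmooth_on_cst.
apply: csmooth_onM => //; first exact: csmooth_on_cst.
apply: csmooth_onV => // [x Ux|]; first by rewrite expf_neq0 ?U0.
exact: csmooth_onX.
Qed.

Lemma smooth_on_potential_numerator (U : set (phase R)) j F : open U ->
  csmooth_on U F -> smooth_on U (fun x => potential_numerator j (F x)).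
Proof.
move=> oU Fs; have Js := csmooth_on_conjc oU F Fs.
apply: (proj1 (csmooth_onD _ _ _ _ _)) => //; last first.
  apply: csmooth_on_real; apply: smooth_onM => //.
    by move=> k; exact: class_C_cst.
  apply: smooth_onB => //; first by move=> k; exact: class_C_cst.
  apply: smooth_onM => //; first by move=> k; exact: class_C_cst.
  exact: smooth_on_sqr_cabs.
apply: csmooth_onB => //; apply: csmooth_onM => //; try exact: csmooth_on_cst.
  exact: csmooth_onD.
exact: csmooth_onB.
Qed.

Lemma open_regular_domain : open regular_domain.
Proof.
have oU0 : open [set x : phase R | toC x.1 != 0].
  rewrite -[X in open X]setTI.
  by apply: open_neq0; [exact: openT|exact: csmooth_on_position].
apply: open_neq0 => //.
apply: csmooth_on_prod => // j; apply: csmooth_onM => //.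
  exact: csmooth_on_fold_value.
by apply: csmooth_onB => //; [exact: csmooth_on_g|exact: csmooth_on_cst].
Qed.

Lemma smooth_on_regularized_hamiltonian C : smooth_on regular_domain
  (fun x => regularized_hamiltonian C (toC x.1) (toC x.2)).
Proof.
have oU := open_regular_domain.
have U0 x : regular_domain x -> toC x.1 != 0 by case.
have gs := csmooth_on_g _ oU U0; have ds := csmooth_on_g_deriv _ oU U0.
have ms := csmooth_on_momentum regular_domain.
have cs (a : R) : smooth_on regular_domain (fun=> a).
  by move=> k; exact: class_C_cst.
apply: smooth_onD => //; last first.
  by apply: smooth_onM => //; exact: smooth_on_sqr_cabs.
apply: smooth_onB => //; first apply: smooth_onD => //.
- apply: smooth_onM => //; last exact: smooth_on_sqr_cabs.
  apply: smooth_onM => //; apply: smooth_onX => //; apply: smooth_onD => //.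
  by apply: smooth_onM => //; exact: smooth_on_sqr_cabs.
- apply: smooth_onM => //; apply: (proj2 (csmooth_onM _ _ _ _ _)) => //.
  by apply: csmooth_onM => //; exact: csmooth_on_conjc.
apply: smooth_onM => //; apply: smooth_on_sum => // j.
rewrite mem_index_iota ltnS => jn.
(* Only [|T_j|] and [|g - a_j|] occur as unsquared moduli; their arguments are nonzero here, so both
   moduli and their inverses are smooth. *)
have nz x Ux := regular_domain_neq0 x j Ux jn.
apply: smooth_onM => //; first apply: smooth_onM => //.
- exact: smooth_on_potential_numerator.
- apply: smooth_onM => //.
    by apply: smooth_on_sqr_cabs => //; exact: csmooth_on_fold_slope.
  apply: smooth_onV => // [x /nz[]|]; first by rewrite cabs_eq0.
  apply: smooth_on_cabs => // [x /nz[]//|].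
  exact: csmooth_on_fold_value.
apply: smooth_onV => // [x /nz[_ ax]|].
  by apply: mulf_neq0; [exact: lt0r_neq0|rewrite cabs_eq0].
apply: smooth_onM => //; apply: smooth_on_cabs => // [x /nz[]//|].
by apply: csmooth_onB => //; exact: csmooth_on_cst.
Qed.

End Extension.

(** * Verification of the regularization conditions *)

Theorem theorem5 (R : realType) (sigma : R) (n : nat) (r z Omega : R)
    (hsigma : sigma = 1 \/ sigma = -1)
    (hn : (2 <= n)%N)
    (hr : 0 < r) (hz : z != 0) (hzH : sigma = -1 -> 0 < z)
    (hsurf : r ^+ 2 + sigma * z ^+ 2 = sigma)
    (hOmega : Omega ^+ 2 = omega_sqr sigma n r) :
  regularizes (hamiltonian sigma n r z Omega) (configuration sigma n r z)
    n (primary n r z) [set w : R[i] | w != 0] (g_map n r z) (dt_ds n r z).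
Proof.
have c0 := primary_neq0 sigma n r z hr hsurf.
have cn j : (1 <= j <= n)%N -> primary n r z j ^+ n = primary n r z 1 ^+ n.
  by case/andP => j1 _; exact: primary_expr.
have fixc j : (1 <= j <= n)%N -> g_map n r z (primary n r z j) = primary n r z j.
  by move=> jn; apply: g_map_fixed => //; exact: cn.
split.
- move=> w /= w0; split.
    by have [] := is_derive_g_map n r z hn w w0.
  rewrite cderive_g_map// /dt_ds /g_deriv.
  (* The product in [dt_ds] is the squared modulus of [w^n - c_1^n], the numerator of [g'] up to a
     constant. *)
  have := prod_sub_primary sigma n r z hn hr hsurf w.
  move=> /(congr1 (fun x => cabs x ^+ 2)); rewrite cabs_prod -prodrXl => ->.
  have wn : w ^+ n != 0 by rewrite expf_neq0.
  have -> : 1 - primary n r z 1 ^+ n / w ^+ n =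
    (w ^+ n - primary n r z 1 ^+ n) / w ^+ n by rewrite mulrBl divff.
  rewrite !cabsM !cabsV !exprMn !exprVn mulrA cabsX -exprM mulnC.
  have cR (a : R) : cabs a%:C ^+ 2 = a ^+ 2 by rewrite cabs_real real_normK ?num_real.
  have -> : n%:R - 1 = (n%:R - 1)%:C :> R[i] by rewrite rmorphB/= rmorph_nat.
  have -> : n%:R = n%:R%:C :> R[i] by rewrite rmorph_nat.
  by rewrite !cR.
- move=> w /= w0 [_ Qw]; rewrite cderive_g_map//.
  by apply: (g_deriv_neq0_off_collision sigma) => // j /Qw[].
- move=> j jn; split; [exact: c0|exact: fixc|].
  by move=> N; apply: g_map_covers => //; exact: cn.
- move=> C.
  exists (fun x => regularized_hamiltonian sigma n r z Omega C (toC x.1) (toC x.2)).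
  split; last first.
    move=> x /= w0 [_ Qx]; rewrite transformed_hamiltonianE// => j /Qx[] //.
  (* Smoothness is established on the open [regular_domain]; what remains is that it contains both
     the configuration points and the collision points. *)
  apply: (smooth_on_subset (regular_domain n r z)); last first.
    exact: smooth_on_regularized_hamiltonian.
  have fz x j : toC x.1 != 0 -> (1 <= j <= n)%N ->
      toC x.1 = primary n r z j \/ g_map n r z (toC x.1) != primary n r z j ->
      fold_value n (primary n r z j) (toC x.1) != 0.
    by move=> w0 jn; apply: fold_value_neq0 => //; exact: cn.
  move=> x [[/= w0 [_ Qx]]|[k kn xk]]; split => /=.
  + exact: w0.
  + rewrite prodf_seq_neq0; apply/allP => j; rewrite mem_index_iota ltnS /= => jn.
    have [gc ga] := Qx j jn.
    by rewrite mulf_neq0 ?subr_eq0// fz//; right.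
  + by rewrite xk.
  + rewrite prodf_seq_neq0; apply/allP => j; rewrite mem_index_iota ltnS /= => jn.
    rewrite mulf_neq0//; last first.
      by rewrite subr_eq0 xk fixc// (primary_neq_antipode sigma).
    apply: fz => //; first by rewrite xk.
    (* At [w = c_k] either [c_k = c_j], the diagonal case of [T_j], or [g w = c_k] differs from
       [c_j]. *)
    rewrite xk fixc//; have [->|?] := eqVneq (primary n r z k) (primary n r z j).
      by left.
    by right.
Qed.
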